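(* Let $n\geq 2$ and write $n=2^kp_1^{\alpha_1}\cdots p_t^{\alpha_t}$ with $k,\alpha_i\geq 0$ and $p_1,\dots,p_t$ distinct odd primes. Then \[GC_n(\mathbb{F}_2)\simeq GC_{2^k}(\mathbb{F}_2)\times GC_{p_1^{\alpha_1}}(\mathbb{F}_2)\times\cdots\times GC_{p_t^{\alpha_t}}(\mathbb{F}_2).\] Moreover, $GC_{2^k}(\mathbb{F}_2)\simeq \mathbb{Z}/2\mathbb{Z}\times\mathbb{Z}/2^{k-1}\mathbb{Z}$ for each $k\geq 1$, while $GC_{p_i^{\alpha_i}}(\mathbb{F}_2)\simeq(\mathbb{Z}/p_i^{\alpha_i}\mathbb{Z})^\times$ for each $1\leq i\leq t$.
   Context: For $n\geq 2$, $(\mathbb{Z}/n\mathbb{Z})^\times$ denotes the multiplicative group of integers modulo $n$, identified with the set of integers in $\{0,1,\dots,n-1\}$ coprime to $n$. $\mathbb{F}_2=\{0,1\}$ is the field with two elements. A binary word on two distinct symbols $a,b$ (ordered formally by $a<b$) is a Christoffel word if it is Lyndon (strictly smaller lexicographically than all its other cyclic conjugates) and cyclically balanced (any two cyclic factors of the same length have numbers of occurrences of $a$ differing by at most $1$). For $m\in(\mathbb{Z}/n\mathbb{Z})^\times$, $c_m(a,b)$ denotes the Christoffel word of length $n$ on the distinct symbols $a,b$, beginning in $a$, with exactly $m$ occurrences of $a$ and $n-m$ occurrences of $b$. The Christoffel matrix $C_m(a,b)$ of size $n$ and type $m$ is the $n\times n$ matrix whose rows are the $n$ cyclic conjugates of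 $c_m(a,b)$ arranged in increasing lexicographic order (relative to $a<b$), so that its first row is $c_m(a,b)$. Equivalently: the first column of $C_m(a,b)$ consists of $m$ entries $a$ followed by $n-m$ entries $b$, and each subsequent column is the cyclic downward shift by $m$ positions of the preceding column. An $n\times n$ Christoffel matrix over $\mathbb{F}_2$ is a matrix $C_m(a,b)$ with $m\in(\mathbb{Z}/n\mathbb{Z})^\times$ and $\{a,b\}=\{0,1\}$ (the order $a<b$ is purely formal). For $n\geq 2$, $GC_n(\mathbb{F}_2)$ denotes the set of all invertible $n\times n$ Christoffel matrices over $\mathbb{F}_2$; it is an abelian subgroup of $GL_n(\mathbb{F}_2)$. By convention $GC_1(\mathbb{F}_2)$ is the trivial group, and $(\mathbb{Z}/1\mathbb{Z})^\times$ is the trivial group. *)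

(* Defs.v *)
From HB Require Import structures.
From mathcomp Require Import all_boot all_order all_algebra all_fingroup.

Set Implicit Arguments.
Unset Strict Implicit.
Unset Printing Implicit Defensive.

Import Order.TTheory GroupScope.

(* Words over the formal ordered alphabet a < b, with a encoded as false and
   b as true; seqlexi carries the lexicographic order. *)
Definition word := seqlexi bool.

Definition conjugate (i : nat) (w : word) : word := rot i w.

(* The inequality is required for every rotation 0 < i < size w, even one that
   gives w back, so that Lyndon words are primitive. *)
Definition lyndon (w : word) : bool :=
  all (fun i => (w < conjugate i w)%O) (iota 1 (size w).-1).

Definition cyclic_factor (l i : nat) (w : word) : word := take l (conjugate i w).

Definition cyclically_balanced (w : word) : bool :=
  [forall l : 'I_(size w).+1, forall i : 'I_(size w), forall j : 'I_(size w),
     count_mem false (cyclic_factor l i w)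
       <= (count_mem false (cyclic_factor l j w)).+1].

Definition christoffel (w : word) : bool := lyndon w && cyclically_balanced w.

Definition sorted_conjugates (w : word) : seq word :=
  sort <=%O [seq conjugate i w | i <- iota 0 (size w)].

Definition christoffel_matrix (R : Type) (n : nat) (w : word) (a b : R) :
    'M[R]_n :=
  \matrix_(i < n, j < n)
    if nth false (nth [::] (sorted_conjugates w) i) j then b else a.

(* The word c_m(a,b) is described by its defining properties: n letters,
   m of them equal to a, first letter a. *)
Definition is_christoffel_matrix (R : finType) (n : nat) (M : 'M[R]_n) : bool :=
  [exists m : 'I_n, exists w : n.-tuple bool, exists a : R, exists b : R,
    [&& coprime m n, a != b, ohead w == Some false, count_mem false w == m,
        christoffel w & M == christoffel_matrix n w a b]].

(* 'GL_n is the unit group of n.-1.+1 x n.-1.+1 matrices, and n.-1.+1 = n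
   for n > 0.  The value at n = 0 is a dummy. *)
Definition GC (n : nat) : {set {'GL_n['F_2]}} :=
  if n <= 1 then 1 else [set g | is_christoffel_matrix (GLval g)].

(* \isog is defined for arbitrary sets of group elements; group_isog also says
   that G and H are subgroups. *)
Definition group_isog (gT hT : finGroupType) (G : {set gT}) (H : {set hT}) :
    Prop :=
  [/\ group_set G, group_set H & G \isog H].

(* Main.v *)
Require Import Defs.
From mathcomp Require Import all_boot all_order all_algebra all_fingroup.
From mathcomp Require Import pgroup cyclic extremal zify.

Set Implicit Arguments.
Unset Strict Implicit.
Unset Printing Implicit Defensive.

Import Order.TTheory GRing.Theory.

(** Everything follows from one uniform description: for every positive n,
    the group GC n is isomorphic to the units modulo 2n.

    Over a commutative ring, let M_u be the n x n matrix whose column j marks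
    the residues uj, uj + 1, ..., uj + u - 1 modulo n, counted with
    multiplicity.  Identify column vectors with the ring R[x]/(x^n - 1); then
    M_u sends f(x) to f(x^u)(x^u - 1)/(x - 1), that is, the substitution of
    x^u for x, twisted by x - 1.  Hence M_u M_v = M_(uv), which is also a
    plain change of summation index ([run_mxM]).  Adding n to u adds the
    all-ones matrix J ([run_mx_modn]), so over the field with two elements
    M_u depends only on u modulo 2n.

    For m coprime to n, the matrix C_m(1, 0) is M_m and C_m(0, 1) is
    M_m + J = M_(m+n).  So Christoffel matrices are the M_u with u coprime to
    n ([is_christoffel_matrixP]).  As all column sums of M_u are u, an
    invertible M_u has u odd; conversely an inverse v of u modulo 2n gives an
    inverse M_v.  Comparing first columns shows that u is determined modulo
    2n.  This gives [GC_isog].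

    The identification of C_m(a, b) starts from the description of a
    Christoffel word by balance and minimality.  Balance makes the
    lexicographic order on the conjugates coincide with the comparison of the
    numbers of b in all prefixes.  So the prefixes of a Christoffel word have
    the least numbers of b among all factors of the same length; since the
    average of these numbers is known and they differ by at most one, the
    prefix of length l has exactly floor(dl/n) of them, where d is the number
    of b in the word ([christoffel_eq_row]).

    It remains to decompose the units modulo 2n by the Chinese remainder
    theorem.  For q odd, the units modulo 2q are the units modulo q; for a
    power of two, the units modulo 2^(k+1) have the classical structure
    generated by -1 and 5. *)

(** * Words compared by prefix counts *)


Lemma count_take_mkseq f l n : l <= n ->
  count id (take l (mkseq f n)) = \sum_(j < l) (f j : nat).
Proof.
move=> le_ln; rewrite /mkseq -map_take take_iota (minn_idPl le_ln).
elim: l {le_ln} => [|l IHl]; first by rewrite big_ord0.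
by rewrite -addn1 iotaD map_cat count_cat IHl addn1 big_ord_recr /= addn0.
Qed.

Lemma word_count_split (w : word) : count_mem false w + count id w = size w.
Proof.
rewrite -(count_predC (pred1 false) w); congr (_ + _).
by apply: eq_count => -[].
Qed.

(** At the first place where the words differ, the counts force u to have the
    smaller letter. *)
Lemma dominated_lexi (u v : word) : size u = size v ->
  (forall l, l <= size u -> count id (take l u) <= count id (take l v)) ->
  (u <= v)%O.
Proof.
elim: u v => [|x u IHu] [|y v] //= [eq_sz] dom; rewrite Order.SeqLexiOrder.lexi_cons.
have := dom 1 isT; rewrite /= !take0 /= !addn0 => le_xy.
have: (x <= y)%O by case: x y le_xy {dom} => [] [].
move=> -> /=; apply/implyP => le_yx; apply: IHu => // l le_l.
have := dom l.+1 le_l; rewrite /=.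
by case: x y le_xy le_yx {dom} => [] [].
Qed.

(** Between balanced words the converse holds: at the first difference v gains
    one occurrence on u, and after this position u can win back at most
    one. *)
Lemma lexi_dominated (u v : word) : size u = size v -> (u <= v)%O ->
    (forall s l, s + l <= size u ->
       count id (take l (drop s u)) <= (count id (take l (drop s v))).+1) ->
  forall l, l <= size u -> count id (take l u) <= count id (take l v).
Proof.
elim: u v => [|x u IHu] [|y v] //= [eq_sz].
rewrite Order.SeqLexiOrder.lexi_cons => /andP[le_xy le_uv] bal [|l] //= le_l.
have [eq_xy|neq_xy] := eqVneq x y.
  rewrite eq_xy leq_add2l; apply: IHu => //; first by rewrite eq_xy lexx in le_uv.
  by move=> s l' le_sl; apply: (bal s.+1 l').
have := bal 1 l; rewrite /= !drop0 add1n => /(_ le_l).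
by case: x y le_xy neq_xy {le_uv bal} => [] [] //= _ _; rewrite add0n add1n.
Qed.

(** * The rows of a Christoffel matrix *)

(** Row e of the matrix with d letters b (encoded as true) in each row.  The
    residue e + dj mod n moves by d at each step, and the letter at j is b
    exactly when the step from j to j + 1 wraps around n.  Row 0 is the
    Christoffel word. *)
Definition row_word n d e : word := mkseq (fun j => n - d <= (e + d * j) %% n) n.

Lemma size_row_word n d e : size (row_word n d e) = n.
Proof. exact: size_mkseq. Qed.

(** Each b is one wrap-around, so the b counted so far are the multiples of n
    passed by e + dj. *)
Lemma count_take_row n d e l : e < n -> d <= n -> l <= n ->
  count id (take l (row_word n d e)) = (e + d * l) %/ n.
Proof.
move=> lt_en le_dn le_ln; rewrite count_take_mkseq //.
have n_gt0 : 0 < n by apply: leq_ltn_trans lt_en.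
elim: l {le_ln} => [|l IHl]; first by rewrite big_ord0 muln0 addn0 divn_small.
rewrite big_ord_recr /= {}IHl mulnS addnCA [in RHS]addnC.
set x := e + _; have lt_r := ltn_pmod x n_gt0.
have -> : (x + d) %/ n = x %/ n + (x %% n + d) %/ n.
  by rewrite {1}(divn_eq x n) -addnA divnMDl.
congr (_ + _); rewrite leq_subLR addnC.
case: leqP => [le_n|lt_n]; last by rewrite divn_small.
have -> : x %% n + d = 1 * n + (x %% n + d - n) by lia.
by rewrite divnMDl // divn_small //; lia.
Qed.

(** Rotation only changes the starting residue of the walk. *)
Lemma rot_row n d e i : i <= n -> 0 < n ->
  rot i (row_word n d e) = row_word n d ((e + d * i) %% n).
Proof.
move=> le_in n_gt0; apply: (@eq_from_nth _ false).
  by rewrite size_rot !size_mkseq.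
rewrite size_rot size_mkseq => j lt_jn.
rewrite nth_mkseq // nth_cat size_drop size_mkseq nth_drop.
rewrite modnDml -addnA -mulnDr.
case: ltnP => [lt_j | le_j].
  by rewrite nth_mkseq //; lia.
rewrite nth_take; last by lia.
rewrite nth_mkseq; last by lia.
congr (_ <= _).
have -> : i + j = n + (j - (n - i)) by lia.
by rewrite mulnDr addnCA modnMDl.
Qed.

Lemma coprime_modn_inv d n : 1 < n -> coprime d n -> exists u, d * u = 1 %[mod n].
Proof.
move=> n_gt1; case: d => [|d].
  by rewrite /coprime gcd0n => /eqP n1; rewrite n1 in n_gt1.
case/(coprimeP _ (ltn0Sn d)) => -[u v] /= eq1; exists u.
have -> : d.+1 * u = v * n + 1 by lia.
by rewrite modnMDl.
Qed.

Section Rows.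
Variables (n d : nat).
Hypotheses (n_gt1 : 1 < n) (le_dn : d <= n) (co_dn : coprime d n).

Lemma row_le e f : e <= f -> f < n -> (row_word n d e <= row_word n d f)%O.
Proof.
move=> le_ef lt_fn; apply: dominated_lexi; rewrite !size_row_word // => l le_l.
rewrite !count_take_row //; last exact: leq_ltn_trans lt_fn.
by rewrite leq_div2r // leq_add2r.
Qed.

(** If e < f, some prefix length l brings f + dl exactly to a multiple of n,
    which e + dl has not reached; the prefix counts then differ. *)
Lemma row_inj e f : e < n -> f < n -> row_word n d e = row_word n d f -> e = f.
Proof.
wlog le_ef : e f / e <= f => [IH lt_e lt_f eq_r|].
  by case: (leqP e f) => [|/ltnW] /IH; [apply | move=> H; symmetry; apply: H].
move=> lt_en lt_fn eq_row; apply/eqP; rewrite eqn_leq le_ef leqNgt; apply/negP => lt_ef.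
have n_gt0 := ltnW n_gt1.
have [u du1] := coprime_modn_inv n_gt1 co_dn.
(* The solution of d * l = - f modulo n. *)
pose l := (u * (n - f)) %% n; have lt_ln : l < n by rewrite ltn_pmod.
have dvd_n : n %| f + d * l.
  rewrite /dvdn -modnDmr modnMmr mulnA -modnMml du1 modnMml mul1n modnDmr.
  by rewrite subnKC ?modnn // ltnW.
have le_ln := ltnW lt_ln.
have := congr1 (fun w : word => count id (take l w)) eq_row.
rewrite !(count_take_row _ le_dn le_ln) // => eq_div.
have : f + d * l <= e + d * l by rewrite -(divnK dvd_n) -eq_div leq_trunc_div.
by rewrite leq_add2r leqNgt lt_ef.
Qed.

(** As d is a unit modulo n, rotating row 0 reaches every row once; the rows
    are already increasing. *)
Lemma sorted_conjugates_row :
  sorted_conjugates (row_word n d 0) = [seq row_word n d e | e <- iota 0 n].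
Proof.
have n_gt0 := ltnW n_gt1.
rewrite /sorted_conjugates size_row_word.
have -> : [seq Defs.conjugate i (row_word n d 0) | i <- iota 0 n]
   = [seq row_word n d e | e <- [seq (d * i) %% n | i <- iota 0 n]].
  rewrite -map_comp; apply/eq_in_map => i; rewrite mem_iota add0n => lt_in /=.
  by rewrite /Defs.conjugate rot_row // 1?ltnW.
have sorted_rows : sorted <=%O [seq row_word n d e | e <- iota 0 n].
  rewrite sorted_map.
  apply: (@sub_in_sorted _ (gtn n) leq); last exact: iota_sorted.
    by move=> e f _ lt_f le_ef; apply: row_le.
  by apply/allP => e; rewrite mem_iota.
rewrite -(sort_le_id sorted_rows); apply/perm_sortP => //.
- exact: le_total.
- exact: le_trans.
- exact: le_anti.
apply: perm_map; rewrite perm_sym.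
have uniq_s : uniq [seq (d * i) %% n | i <- iota 0 n].
  rewrite map_inj_in_uniq ?iota_uniq // => i j; rewrite !mem_iota !add0n.
  move=> /= lt_i lt_j /eqP.
  wlog le_ij : i j lt_i lt_j / i <= j => [IH|].
    by case: (leqP i j) => [|/ltnW] /IH H; [apply: H | rewrite eq_sym => ?; rewrite H].
  rewrite eq_sym eqn_mod_dvd ?leq_mul2l ?le_ij ?orbT // -mulnBr.
  rewrite Gauss_dvdr 1?coprime_sym //.
  case: (posnP (j - i)) => [|ji_gt0 /dvdn_leq]; first by lia.
  by move=> /(_ ji_gt0); lia.
apply: uniq_perm; rewrite ?iota_uniq //.
have sub_s : {subset [seq (d * i) %% n | i <- iota 0 n] <= iota 0 n}.
  by move=> _ /mapP[i _ ->]; rewrite mem_iota add0n ltn_pmod.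
have [|_ eq_s] := uniq_min_size uniq_s sub_s; last by move=> e; rewrite eq_s.
by rewrite size_map.
Qed.

(** Row 0 is the smallest of its conjugates because all prefix counts increase
    with the starting residue; it is balanced because starting residues lie in
    an interval of length n, so that the corresponding floors differ by at most
    one. *)
Lemma christoffel_row : christoffel (row_word n d 0).
Proof.
have n_gt0 := ltnW n_gt1.
apply/andP; split.
  apply/allP => i; rewrite mem_iota size_row_word => /andP[i_gt0].
  rewrite addnC addn1 prednK // => lt_in.
  rewrite /Defs.conjugate rot_row 1?ltnW // add0n lt_neqAle row_le ?ltn_pmod // andbT.
  apply/eqP => /row_inj; rewrite ltn_pmod // => /(_ n_gt0 isT)/esym/eqP.
  by rewrite -[_ == _]/(n %| _) Gauss_dvdr 1?coprime_sym // gtnNdvd.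
rewrite /cyclically_balanced size_row_word.
apply/forallP => -[l /= le_l]; apply/forallP => i; apply/forallP => j.
rewrite /cyclic_factor /Defs.conjugate !rot_row ?(ltnW (ltn_ord _)) // !add0n.
rewrite ltnS in le_l.
have cnt e : e < n -> count_mem false (take l (row_word n d e)) + (e + d * l) %/ n = l.
  move=> lt_e; rewrite -(count_take_row lt_e le_dn le_l).
  by rewrite (word_count_split (take l _)) size_takel ?size_row_word.
set e := (d * i) %% n; set f := (d * j) %% n.
have lt_e : e < n by rewrite ltn_pmod.
have lt_f : f < n by rewrite ltn_pmod.
have := cnt e lt_e; have := cnt f lt_f.
have : (f + d * l) %/ n <= ((e + d * l) %/ n).+1.
  by rewrite -add1n -divnMDl // leq_div2r //; lia.
by move: (count_mem _ _) (count_mem _ _) (_ %/ _) (_ %/ _) => *; lia.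
Qed.
End Rows.

(** * A Christoffel word is determined by its letter counts *)

Lemma count_nth (s : seq bool) l : count id (take l s) = \sum_(j < l) nth false s j.
Proof.
elim: l s => [|l IHl] [|x s] //=; rewrite ?big_ord0 //.
  by rewrite big1 // => j _; rewrite nth_nil.
by rewrite big_ord_recl IHl.
Qed.

(** Each of the l columns of the array of conjugates is itself a conjugate. *)
Lemma sum_count_rot (w : seq bool) l : l <= size w ->
  \sum_(i < size w) count id (take l (rot i w)) = l * count id w.
Proof.
move=> le_l; under eq_bigr => i _ do rewrite count_nth.
rewrite exchange_big /=.
have -> : l * count id w = \sum_(j < l) count id w by rewrite sum_nat_const card_ord.
apply: eq_bigr => j _.
have lt_j := leq_trans (ltn_ord j) le_l.
have /permEl/seq.permP/(_ id) <- := perm_rot j w; rewrite -[rot j w]take_size size_rot count_nth.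
apply: eq_bigr => i _; rewrite !nth_cat !size_drop !nth_drop.
have lt_i := ltn_ord i.
case: ltnP => [lt1|le1]; case: ltnP => [lt2|le2]; rewrite ?nth_take; try lia.
  by rewrite addnC.
by congr (nat_of_bool (nth _ _ _)); lia.
Qed.

Lemma take_drop_rot (T : Type) (s : seq T) i l : i + l <= size s ->
  take l (drop i s) = take l (rot i s).
Proof. by move=> le_il; rewrite /rot takel_cat // size_drop; lia. Qed.

(** All factors of length l have T or T + 1 letters b, where T is the count in
    the prefix, and the prefix itself attains T.  Summing over the n starting
    positions gives n T <= d l < n (T + 1), which determines T. *)
Lemma christoffel_eq_row n d (w : word) :
  size w = n -> count id w = d -> christoffel w -> w = row_word n d 0.
Proof.
move=> sz_w cnt_w; rewrite /christoffel /lyndon /cyclically_balanced sz_w.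
case/andP=> /allP lyn_w /forallP bal_w.
have [n0|n_gt0] := posnP n; first by move: sz_w; rewrite n0 => /size0nil ->.
have le_dn : d <= n by rewrite -sz_w -cnt_w count_size.
(* Balance is stated for the letter a; complementing in a factor of fixed
   length transfers it to b. *)
have bal l i j : l <= n -> i < n -> j < n ->
    count id (take l (rot i w)) <= (count id (take l (rot j w))).+1.
  move=> le_l lt_i lt_j.
  have sz k : size (take l (rot k w)) = l by rewrite size_takel // size_rot sz_w.
  rewrite -ltnS in le_l.
  have /forallP/(_ (Ordinal lt_j))/forallP/(_ (Ordinal lt_i)) := bal_w (Ordinal le_l).
  rewrite -(leq_add2r (count id (take l (rot j w)))).
  rewrite (word_count_split (take l (rot j w))) addSnnS sz.
  have := word_count_split (take l (rot i w)); rewrite sz => {1}<-.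
  by rewrite leq_add2l.
have dom l i : l <= n -> i < n -> count id (take l w) <= count id (take l (rot i w)).
  move=> le_l lt_i; apply: lexi_dominated; rewrite ?sz_w ?size_rot //.
    have [->|i_gt0] := posnP i; first by rewrite rot0.
    by apply/ltW/lyn_w; rewrite mem_iota; lia.
  move=> s l' le_sl; rewrite !take_drop_rot ?size_rot ?sz_w //.
  have [->|l_gt0] := posnP l'; first by rewrite !take0.
  have lt_s : s < n by lia.
  rewrite rot_add_mod ?sz_w; [|exact: ltnW|exact: ltnW].
  have [lt_si|le_si|eq_si] := ltngtP (s + i) n; try by apply: bal; lia.
  rewrite eq_si -sz_w rot_size; have := bal l' s 0.
  by rewrite rot0; apply; lia.
have cnt l : l <= n -> count id (take l w) = (d * l) %/ n.
  move=> le_l.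
  have sum_l : \sum_(i < n) count id (take l (rot i w)) = d * l.
    by rewrite -sz_w sum_count_rot ?sz_w // cnt_w mulnC.
  set T := count id (take l w).
  have lb : n * T <= d * l.
    rewrite -sum_l -[n in n * T](card_ord n) -sum_nat_const.
    by apply: leq_sum => i _; apply: dom.
  have ub : d * l < n * T.+1.
    rewrite -sum_l -[n in n * T.+1](card_ord n) -sum_nat_const.
    rewrite (bigD1 (Ordinal n_gt0)) //= [X in _ < X](bigD1 (Ordinal n_gt0)) //=.
    rewrite rot0 -/T -addSn leq_add2l.
    by apply: leq_sum => i _; rewrite /T -{2}(rot0 w); apply: bal.
  apply/eqP; rewrite eqn_leq leq_divRL // mulnC lb /=.
  by rewrite -ltnS ltn_divLR // [_ * n]mulnC.
apply: le_anti; apply/andP; split; apply: dominated_lexi;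
  rewrite ?size_row_word ?sz_w // => l le_l.
  by rewrite count_take_row // cnt.
by rewrite count_take_row // cnt.
Qed.

(** * The multiplicative family of run matrices *)

Section RunMatrix.
Variable R : comPzRingType.
Local Open Scope ring_scope.

(** The operator f(x) |-> f(x^u)(1 + x + ... + x^(u-1)) on R[x]/(x^n - 1), in
    the basis of the powers of x.  Allowing u >= n, with multiplicities, is
    what makes the family multiplicative. *)
Definition run_mx n u : 'M[R]_n :=
  \matrix_(i < n, j < n) \sum_(s < u) ((u * j + s) %% n == i)%N%:R.

Lemma sum_ord_mul (F : nat -> R) u v :
  \sum_(t < v) \sum_(s < u) F (u * t + s)%N = \sum_(r < u * v) F r.
Proof.
elim: v => [|v IHv]; first by rewrite muln0 !big_ord0.
by rewrite big_ord_recr {}IHv mulnSr big_split_ord.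
Qed.

(** Splitting a run of length u v into v runs of length u, each starting at a
    multiple of u. *)
Lemma run_mxM n u v : run_mx n u *m run_mx n v = run_mx n (u * v).
Proof.
apply/matrixP => i j; rewrite !mxE.
rewrite -(sum_ord_mul (fun r => ((u * v * j + r) %% n == i)%N%:R)).
under eq_bigr => k _ do rewrite !mxE mulr_sumr.
rewrite exchange_big /=; apply: eq_bigr => t _.
have n_gt0 : (0 < n)%N by apply: leq_trans (ltn_ord i).
rewrite (bigD1 (Ordinal (ltn_pmod (v * j + t)%N n_gt0))) //= eqxx mulr1.
rewrite [X in _ + X]big1 ?addr0 => [|k /negPf neq_k]; last first.
  by rewrite eq_sym -val_eqE /= in neq_k; rewrite neq_k mulr0.
apply: eq_bigr => s _; rewrite addnA -mulnA -mulnDr.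
by rewrite -modnDml modnMmr modnDml.
Qed.

Lemma run_mx1 n : run_mx n 1 = 1%:M.
Proof.
apply/matrixP => i j; rewrite !mxE big_ord1 mul1n addn0 modn_small //.
by rewrite eq_sym.
Qed.

Lemma sum_period n c (i : 'I_n) : \sum_(s < n) ((c + s) %% n == i)%N%:R = 1 :> R.
Proof.
elim: c => [|c IHc].
  rewrite (bigD1 i) //= add0n modn_small // eqxx big1 ?addr0 // => s neq_si.
  by rewrite add0n modn_small // val_eqE (negPf neq_si).
have n_gt0 : (0 < n)%N by apply: leq_trans (ltn_ord i).
rewrite -[RHS]IHc; case: n n_gt0 i {IHc} => // n _ i.
rewrite big_ord_recr [RHS]big_ord_recl /= addn0 addrC addSnnS modnDr.
by congr (_ + _); apply: eq_bigr => s _; rewrite addSnnS.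
Qed.

(** Every n consecutive residues cover each class once, so each full turn adds
    the all-ones matrix. *)
Lemma run_mx_modn n u : run_mx n u = run_mx n (u %% n)%N + const_mx (u %/ n)%N%:R.
Proof.
rewrite {1}(divn_eq u n); elim: (u %/ n)%N => [|q IHq].
  by rewrite mul0n addr0.
rewrite mulSn -addnA addnC; set w := (_ + _)%N in IHq *.
rewrite -natr1.
apply/matrixP => i j; have /matrixP/(_ i j) := IHq; rewrite !mxE => eq_w.
rewrite addrA -{}eq_w big_split_ord /=; congr (_ + _).
  by apply: eq_bigr => s _; rewrite mulnDl -addnA addnCA mulnC modnMDl.
rewrite -[RHS](sum_period (w * j + w) i); apply: eq_bigr => s _.
by rewrite mulnDl -addnA addnCA mulnC modnMDl addnA.
Qed.

(** For u <= n a residue is hit at most once.  Since uj + s = i modulo n is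
    equivalent to s = i + (n - u)j, the entry depends on the same residue as
    the letter j of row i of the Christoffel matrix. *)
Lemma run_mx_le n u i j : (u <= n)%N ->
  run_mx n u i j = ((i + (n - u) * j) %% n < u)%N%:R.
Proof.
move=> le_un; rewrite mxE; set e := (_ %% n)%N.
have n_gt0 : (0 < n)%N by apply: leq_trans (ltn_ord i).
have eq_e (s : 'I_u) : ((u * j + s) %% n == i)%N = (s == e :> nat).
  have lt_s : (s < n)%N by apply: leq_trans le_un.
  rewrite -{1}(modn_small (ltn_ord i)) -(eqn_modDr ((n - u) * j)) -/e.
  have -> : (u * j + s + (n - u) * j = j * n + s)%N.
    by rewrite addnAC -mulnDl subnKC // mulnC.
  by rewrite modnMDl modn_small.
under eq_bigr => s _ do rewrite eq_e.
case: ltnP => [lt_eu|le_ue]; last first.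
  by apply: big1 => s _; rewrite (ltn_eqF (leq_trans (ltn_ord s) le_ue)).
rewrite (bigD1 (Ordinal lt_eu)) //= eqxx big1 ?addr0 // => s.
by rewrite -val_eqE => /negPf /= ->.
Qed.

(** This row eigenvector shows that M_u is singular when u is zero in R. *)
Lemma colsum_run_mx n u : const_mx 1 *m run_mx n u = const_mx u%:R :> 'rV_n.
Proof.
apply/matrixP => i j; rewrite !mxE.
under eq_bigr => k _ do rewrite !mxE mul1r.
rewrite exchange_big /=.
have n_gt0 : (0 < n)%N by apply: leq_trans (ltn_ord j).
rewrite -[u in RHS]card_ord -sumr_const; apply: eq_bigr => s _.
rewrite (bigD1 (Ordinal (ltn_pmod (u * j + s)%N n_gt0))) //= eqxx.
rewrite big1 ?addr0 // => k.
by rewrite eq_sym -val_eqE => /negPf /= ->.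
Qed.

Lemma christoffel_matrix_row n d (a b : R) i j :
    (1 < n)%N -> (d <= n)%N -> coprime d n ->
  christoffel_matrix n (row_word n d 0) a b i j
  = if ((i + d * j) %% n < n - d)%N then a else b.
Proof.
move=> n_gt1 le_dn co_dn; rewrite mxE sorted_conjugates_row //.
rewrite (nth_map 0%N) ?size_iota // nth_iota // add0n nth_mkseq //.
by rewrite leqNgt; case: (_ < _)%N.
Qed.
End RunMatrix.

(** * Christoffel matrices over the field with two elements *)

Section BinaryRunMatrix.
Local Open Scope ring_scope.

Lemma coprime_double n u : coprime (2 * n) u = odd u && coprime n u.
Proof. by rewrite coprimeMl coprime2n. Qed.

Lemma natr_F2 k : k%:R = (odd k)%:R :> 'F_2.
Proof. by rewrite -modn2 Fp_nat_mod. Qed.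

(** Two full turns add J + J = 0. *)
Lemma run_mx_mod_double n u :
  run_mx 'F_2 n (u %% (2 * n))%N = run_mx 'F_2 n u.
Proof.
have [->|n_gt0] := posnP n; first by apply/matrixP => -[].
rewrite run_mx_modn [RHS]run_mx_modn modn_dvdm ?dvdn_mull //.
congr (_ + const_mx _); rewrite {2}(divn_eq u (2 * n)) mulnA divnMDl //.
by rewrite natr_F2 [RHS]natr_F2 oddD oddM andbF.
Qed.

(** With r = u mod 2n, the last entry of the first column shows that r < n,
    and the second one that r <= 1. *)
Lemma run_mx_inj1 n u : (0 < n)%N -> coprime (2 * n) u ->
  run_mx 'F_2 n u = 1%:M -> u = 1 %[mod 2 * n].
Proof.
move=> n_gt0; rewrite -coprime_modr -run_mx_mod_double => co_u M1.
have N_gt0 : (0 < 2 * n)%N by rewrite muln_gt0.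
have := ltn_pmod u N_gt0; set r := (u %% _)%N in co_u M1 * => lt_r.
have [n_gt1|n_le1] := ltnP 1 n; last first.
  have n1 : n = 1%N by apply/eqP; rewrite eqn_leq n_le1.
  by move: lt_r co_u; rewrite n1; case: r {M1} => [|[|r]].
have entry i : (i < n)%N ->
    (i < r %% n)%N%:R + (r %/ n)%N%:R = (i == 0)%N%:R :> 'F_2.
  move=> lt_in; have /matrixP/(_ (Ordinal lt_in) (Ordinal n_gt0)) := M1.
  rewrite run_mx_modn [LHS]mxE run_mx_le; last by rewrite ltnW ?ltn_pmod.
  by rewrite /= muln0 addn0 modn_small // !mxE.
have even_q : ~~ odd (r %/ n).
  have /entry : (n.-1 < n)%N by rewrite prednK.
  rewrite ltnNge -ltnS prednK // ltn_pmod //= add0r natr_F2.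
  have -> : (n.-1 == 0)%N = false by lia.
  by case: odd.
have q0 : (r %/ n = 0)%N.
  by have : (r %/ n < 2)%N; [rewrite ltn_divLR | case: (r %/ n)%N even_q => [|[]]].
have lt_rn : (r < n)%N by rewrite ltnNge -divn_gt0 // q0.
have le_r1 : (r <= 1)%N.
  rewrite leqNgt; apply/negP => r_gt1.
  by have := entry 1%N n_gt1; rewrite q0 addr0 modn_small // r_gt1.
have r_neq0 : r != 0%N by apply: contraTneq co_u => ->; rewrite coprime_double.
by rewrite modn_small; lia.
Qed.

Lemma run_mx_unit n u : (0 < n)%N -> coprime (2 * n) u ->
  run_mx 'F_2 n u \in unitmx.
Proof.
move=> n_gt0; rewrite coprime_sym => co_u.
have N_gt1 : (1 < 2 * n)%N by lia.
have [v uv1] := coprime_modn_inv N_gt1 co_u.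
have: run_mx 'F_2 n u *m run_mx 'F_2 n v = 1%:M.
  by rewrite run_mxM -run_mx_mod_double uv1 run_mx_mod_double run_mx1.
by case/mulmx1_unit.
Qed.

Lemma unit_run_mx_odd n u : (0 < n)%N -> run_mx 'F_2 n u \in unitmx -> odd u.
Proof.
case: n => // n _ uM; apply/negPn/negP => /negPf ev_u.
have := mulmxK uM (const_mx 1 : 'rV_n.+1); rewrite colsum_run_mx natr_F2 ev_u.
have -> : const_mx false%:R = 0 :> 'rV['F_2]_n.+1 by apply/matrixP => i j; rewrite !mxE.
by rewrite mul0mx => /matrixP/(_ 0 0); rewrite !mxE.
Qed.

(** The number of full turns in u decides between the two choices of symbols:
    M_u is C_m(1 + q, q) for m = u mod n and q = floor(u / n). *)
Lemma is_christoffel_matrixP n (M : 'M['F_2]_n) : (1 < n)%N ->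
  reflect (exists2 u, coprime n u & M = run_mx 'F_2 n u) (is_christoffel_matrix M).
Proof.
move=> n_gt1; have n_gt0 := ltnW n_gt1.
have co_sub m : (m <= n)%N -> coprime (n - m) n = coprime m n.
  move=> le_mn; rewrite -{2 3}(subnK le_mn) /coprime gcdnDl -{1}[RHS]/(_ == 1)%N.
  by rewrite gcdnDr gcdnC.
apply: (iffP existsP) => [[m /existsP[w /existsP[a /existsP[b]]]]|[u co_u ->]].
  case/and5P => co_m neq_ab _ /eqP cnt_m /andP[chr_w /eqP ->].
  have le_m := ltnW (ltn_ord m).
  have cnt_w : count id w = (n - m)%N.
    by have := word_count_split w; rewrite size_tuple cnt_m; lia.
  have := christoffel_eq_row (size_tuple w) cnt_w chr_w => ->.
  have co_d : coprime (n - m) n by rewrite co_sub.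
  have [[-> ->]|[-> ->]] : (a = 1 /\ b = 0) \/ (a = 0 /\ b = 1).
    case: a b neq_ab => [[|[|//]] a_lt] [[|[|//]] b_lt] // _; [right|left];
      by split; apply: val_inj.
    exists m; first by rewrite coprime_sym.
    apply/matrixP => i j; rewrite christoffel_matrix_row ?leq_subr // run_mx_le //.
    by rewrite subKn //; case: ltnP.
  exists (n + m)%N; first by rewrite /coprime gcdnDl -/(coprime _ _) coprime_sym.
  rewrite run_mx_modn modnDl modn_small // divnDl ?dvdnn // divnn n_gt0 divn_small //.
  apply/matrixP => i j; rewrite christoffel_matrix_row ?leq_subr // mxE run_mx_le //.
  by rewrite subKn // mxE; case: ltnP => _; rewrite ?add0r //; apply: val_inj.
pose m := Ordinal (ltn_pmod u n_gt0); have le_m := ltnW (ltn_ord m).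
have co_m : coprime m n by rewrite coprime_modl coprime_sym.
have m_gt0 : (0 < m)%N.
  by rewrite lt0n; apply: contraTneq co_m => ->; rewrite /coprime gcd0n gtn_eqF.
pose q : 'F_2 := (u %/ n)%N%:R.
exists m; apply/existsP; exists (Tuple (introT eqP (size_row_word n (n - m) 0))).
apply/existsP; exists (1 + q); apply/existsP; exists q.
have neq_q : 1 + q != q by rewrite -subr_eq0 addrK oner_neq0.
rewrite co_m neq_q /=.
rewrite christoffel_row ?leq_subr ?co_sub //=.
apply/and3P; split.
- by rewrite /row_word -(prednK n_gt0) /= prednK // subKn // muln0 mod0n leqn0 (gtn_eqF m_gt0).
- have := word_count_split (row_word n (n - m) 0).
  rewrite -{2}[row_word _ _ _]take_size size_row_word count_take_row ?leq_subr //.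
  by rewrite mulnK // => /(congr1 (subn^~ (n - m)%N)); rewrite addnK subKn // => ->.
apply/eqP/matrixP => i j; rewrite christoffel_matrix_row ?leq_subr ?co_sub //.
rewrite run_mx_modn mxE run_mx_le // mxE subKn //.
by rewrite -/q; case: ltnP; rewrite ?add0r.
Qed.
End BinaryRunMatrix.

(** * Groups parametrised by units *)

Section UnitImage.
Local Open Scope group_scope.

Lemma group_isog_sym (gT hT : finGroupType) (G : {set gT}) (H : {set hT}) :
  group_isog G H -> group_isog H G.
Proof.
by case=> gG gH; rewrite (isog_sym (Group gG) (Group gH)) => isoHG; split.
Qed.

Lemma group_isog_trans (gT hT kT : finGroupType) (G : {set gT}) (H : {set hT})
    (K : {set kT}) :
  group_isog G H -> group_isog H K -> group_isog G K.
Proof.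
case=> gG gH isoGH [_ gK isoHK]; split=> //.
exact: (@isog_trans _ _ _ (Group gG) (Group gH) (Group gK)).
Qed.

Lemma coprime_unit_Zp N (x : {unit 'Z_N}) : (1 < N)%N -> coprime N (val x : 'Z_N).
Proof. by move=> N_gt1; rewrite -(unitZpE _ N_gt1) natr_Zp; apply: valP. Qed.

(** An isomorphism from the units modulo N onto A, given as a function on nat.
    Working with integers instead of elements of 'Z_N lets the same u be used
    for several moduli at once, and avoids the convention that 'Z_1 is 'Z_2.
    Surjectivity is replaced by the bound on the cardinal of A. *)
Definition unit_param (N : nat) (gT : finGroupType) (phi : nat -> gT)
    (A : {set gT}) : Prop :=
  [/\ forall u, phi (u %% N)%N = phi u,
      forall u v, coprime N u -> coprime N v -> phi (u * v)%N = phi u * phi v,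
      forall u, coprime N u -> phi u = 1 -> u = 1 %[mod N],
      forall u, coprime N u -> phi u \in A
    & (#|A| <= totient N)%N].

Lemma unit_param_isog N (gT : finGroupType) (phi : nat -> gT) (A : {set gT}) :
  (1 < N)%N -> unit_param N phi A -> group_isog A (units_Zp N).
Proof.
move=> N_gt1 [phi_mod phiM phi_inj1 phiA le_A].
pose f (x : {unit 'Z_N}) : gT := phi (val x : 'Z_N).
have fM : {in units_Zp N &, {morph f : x y / x * y}}.
  move=> x y _ _; rewrite /f -phiM ?coprime_unit_Zp //.
  rewrite -[RHS]phi_mod; congr phi; rewrite FinRing.val_unitM /=.
  by congr (_ %% _)%N; apply: Zp_cast.
pose F := Morphism fM.
have inj_F : 'injm F.
  apply/subsetP => x /morphpreP[_ /set1P /= /(phi_inj1 _ (coprime_unit_Zp x N_gt1)) x1].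
  apply/set1P/val_inj/val_inj; move: x1; rewrite modn_small; last first.
    by rewrite -[X in (_ < X)%N](Zp_cast N_gt1) ltn_ord.
  by rewrite modn_small // => ->.
have im_F : F @* units_Zp N = A.
  apply/eqP; rewrite eqEcard card_injm // card_units_Zp ?(ltnW N_gt1) // le_A.
  rewrite andbT; apply/subsetP => _ /morphimP[x _ _ ->].
  exact/phiA/coprime_unit_Zp.
rewrite -im_F; split; [exact: groupP | exact: groupP |].
rewrite isog_sym; exact: (sub_isog (subxx _) inj_F).
Qed.

(** The Chinese remainder theorem in this language: the components are
    evaluated at the same u, injectivity is the uniqueness of a solution of
    the congruences, and counting replaces its existence. *)
Lemma unit_param_prod (I : finType) (N a : nat) (q : I -> nat)
    (gT : finGroupType) (hT : I -> finGroupType)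
    (phi : nat -> gT) (psi : forall i, nat -> hT i)
    (A : {set gT}) (B : forall i, {set hT i}) :
  a %| N -> (forall i, q i %| N) ->
  (forall u, u = 1 %[mod a] -> (forall i, u = 1 %[mod q i]) -> u = 1 %[mod N]) ->
  (totient a * \prod_i totient (q i) <= totient N)%N ->
  unit_param a phi A -> (forall i, unit_param (q i) (psi i) (B i)) ->
  unit_param N
    (fun u => (phi u, [ffun i => psi i u] : {dffun forall i, hT i}))
    (setX A (setXn B)).
Proof.
move=> dv_a dv_q crt le_tot [phi_mod phiM phi_inj1 phiA le_A] paramB.
have co_a u : coprime N u -> coprime a u by apply: coprime_dvdl.
have co_q i u : coprime N u -> coprime (q i) u by apply: coprime_dvdl.
split.
- move=> u; apply: (f_equal2 pair); first by rewrite -phi_mod modn_dvdm.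
  apply/ffunP => i; rewrite !ffunE; have [psi_mod _ _ _ _] := paramB i.
  by rewrite -psi_mod modn_dvdm.
- move=> u v co_u co_v; apply: (f_equal2 pair); first by apply: phiM; apply: co_a.
  apply/ffunP => i; rewrite mulg_ffun !ffunE; have [_ psiM _ _ _] := paramB i.
  by apply: psiM; apply: co_q.
- move=> u co_u u1; apply: crt => [|i].
    by apply: phi_inj1; [apply: co_a | apply: (congr1 fst u1)].
  have [_ _ psi_inj1 _ _] := paramB i; apply: psi_inj1; first exact: co_q.
  have := congr1 (fun x : gT * {dffun forall i, hT i} => x.2 i) u1.
  by rewrite /= !ffunE.
- move=> u co_u; rewrite inE /= phiA ?co_a //=; apply/setXnP => i.
  by rewrite ffunE; have [_ _ _ psiB _] := paramB i; apply/psiB/co_q.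
rewrite cardsX cardsXn; apply: leq_trans le_tot; apply: leq_mul => //.
by apply: leq_prod => i _; have [] := paramB i.
Qed.
End UnitImage.

(** * The group of invertible Christoffel matrices *)

Section GCGroup.
Local Open Scope group_scope.

(** The identity is a default for the u that are not coprime to 2n. *)
Definition run_GL n u : {'GL_n['F_2]} :=
  insubd (1 : {'GL_n['F_2]}) (run_mx 'F_2 n.-1.+1 u).

Lemma val_run_GL n u : (0 < n)%N -> coprime (2 * n) u ->
  GLval (run_GL n u) = run_mx 'F_2 n.-1.+1 u.
Proof.
case: n => // n _ co_u; apply: (insubdK (1 : {'GL_n.+1['F_2]})).
exact: run_mx_unit co_u.
Qed.

Lemma run_GL_mod n u : (0 < n)%N -> run_GL n (u %% (2 * n)) = run_GL n u.
Proof. by case: n => // n _; rewrite /run_GL run_mx_mod_double. Qed.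

Lemma run_GLM n u v : (0 < n)%N -> coprime (2 * n) u -> coprime (2 * n) v ->
  run_GL n (u * v) = run_GL n u * run_GL n v.
Proof.
move=> n_gt0 co_u co_v; apply: val_inj; rewrite FinRing.val_unitM.
have := val_run_GL n_gt0; rewrite /GLval => vE.
rewrite [LHS]vE ?coprimeMr ?co_u // [X in (X * _)%R]vE // [X in (_ * X)%R]vE //.
exact/esym/run_mxM.
Qed.

Lemma run_GL_inj1 n u : (0 < n)%N -> coprime (2 * n) u ->
  run_GL n u = 1 -> u = 1 %[mod 2 * n].
Proof.
case: n => // n n_gt0 co_u u1; apply: (@run_mx_inj1 n.+1) => //.
by rewrite -(val_run_GL n_gt0 co_u) u1.
Qed.

(** This includes n = 1, where both sides reduce to the identity. *)
Lemma mem_GC n (g : {'GL_n['F_2]}) : (0 < n)%N ->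
  reflect (exists2 u, coprime (2 * n) u & g = run_GL n u) (g \in GC n).
Proof.
case: n g => // n g n_gt0; rewrite /GC; case: leqP => [n_gt1 | n_le0].
  rewrite inE; apply: (iffP (@is_christoffel_matrixP n.+1 _ n_gt1)) => [[u co_u def_g]|[u co_u ->]].
    have co2_u : coprime (2 * n.+1) u.
      rewrite coprime_double co_u andbT (@unit_run_mx_odd n.+1) // -def_g.
      by case: (g).
    by exists u => //; apply: val_inj; rewrite [RHS](val_run_GL n_gt0 co2_u).
  exists u; last exact: (val_run_GL n_gt0 co_u).
  by move: co_u; rewrite coprime_double => /andP[].
have n0 : n = 0%N by apply/eqP; rewrite -leqn0.
subst n; apply: (iffP set1P) => [-> | [u co_u ->]].
  exists 1%N; first exact: coprimen1.
  by apply/esym/val_inj; rewrite [LHS](val_run_GL n_gt0) ?coprimen1 // run_mx1.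
rewrite -run_GL_mod // modn2; rewrite coprime2n in co_u; rewrite co_u.
by apply/val_inj; rewrite [LHS]val_run_GL // run_mx1.
Qed.

Lemma card_GC_le n : (0 < n)%N -> (#|GC n| <= totient (2 * n))%N.
Proof.
move=> n_gt0; have N_gt1 : (1 < 2 * n)%N by lia.
rewrite -(card_units_Zp (ltnW N_gt1)).
apply: leq_trans (leq_imset_card (fun x : {unit 'Z_(2 * n)} => run_GL n (val x : 'Z_(2 * n))) _).
apply/subset_leq_card/subsetP => g /(mem_GC _ n_gt0)[u co_u ->].
have unit_u : (u%:R : 'Z_(2 * n))%R \is a GRing.unit by rewrite unitZpE.
apply/imsetP; exists (FinRing.Unit unit_u); first by rewrite inE.
by rewrite /= val_Zp_nat // run_GL_mod.
Qed.

Lemma GC_unit_param n : (0 < n)%N -> unit_param (2 * n) (run_GL n) (GC n).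
Proof.
move=> n_gt0; split.
- by move=> u; apply: run_GL_mod.
- by move=> u v; apply: run_GLM.
- by move=> u; apply: run_GL_inj1.
- by move=> u co_u; apply/(mem_GC _ n_gt0); exists u.
- exact: card_GC_le.
Qed.

(** The units modulo 2n, rather than modulo n, record both the type m and the
    choice of the symbols a and b. *)
Lemma GC_isog n : (0 < n)%N -> group_isog (GC n) (units_Zp (2 * n)).
Proof. by move=> n_gt0; apply: unit_param_isog (GC_unit_param n_gt0); lia. Qed.

Lemma totient_double q : odd q -> totient (2 * q) = totient q.
Proof. by move=> odd_q; rewrite totient_coprime ?coprime2n // mul1n. Qed.

Definition to_unit_Zp q u : {unit 'Z_q} := insubd (1 : {unit 'Z_q}) (u%:R : 'Z_q)%R.

(** An odd integer congruent to 1 modulo q is congruent to 1 modulo 2q, so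
    reduction modulo q is injective, and both groups have the same order. *)
Lemma units_Zp_double_isog q : odd q -> group_isog (units_Zp (2 * q)) (units_Zp q).
Proof.
move=> odd_q; have q_gt0 := odd_gt0 odd_q; apply: group_isog_sym.
have co2q : coprime 2 q by rewrite coprime2n.
(* For q = 1 the ring 'Z_q is 'Z_2, so u%:R need not be a unit there; but the
   unit group is trivial. *)
have triv (x y : {unit 'Z_q}) : (q <= 1)%N -> x = y.
  move=> q_le1; have q1 : q = 1%N by apply/eqP; rewrite eqn_leq q_le1.
  have /card_le1_eqP le1 : #|units_Zp q| <= 1 by rewrite card_units_Zp // q1.
  by apply: le1; rewrite inE.
have valE u : (1 < q)%N -> coprime q u -> val (to_unit_Zp q u) = (u%:R)%R.
  by move=> q_gt1 co_u; apply: insubdK; rewrite -[_ \in _]/(_ \is a GRing.unit) unitZpE.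
apply: (@unit_param_isog _ _ (to_unit_Zp q)); first by lia.
split.
- move=> u; have [q_le1|q_gt1] := leqP q 1; first exact: triv.
  rewrite /to_unit_Zp; congr insubd.
  by rewrite -[LHS]Zp_nat_mod // modn_dvdm ?dvdn_mull // Zp_nat_mod.
- move=> u v; rewrite !coprime_double => /andP[_ co_u] /andP[_ co_v].
  have [q_le1|q_gt1] := leqP q 1; first exact: triv.
  by apply: val_inj; rewrite FinRing.val_unitM !valE ?coprimeMr ?co_u // natrM.
- move=> u; rewrite coprime_double => /andP[odd_u co_u] u1.
  apply/eqP; rewrite chinese_remainder //; apply/andP; split.
    by rewrite !modn2 odd_u.
  have [q_le1|q_gt1] := leqP q 1.
    by rewrite (_ : q = 1%N) ?modn1 //; lia.
  have := congr1 (fun x : {unit 'Z_q} => val (val x : 'Z_q)) u1.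
  by rewrite /= valE // val_Zp_nat // -(val_Zp_nat q_gt1 1) => ->.
- by move=> u _; rewrite inE.
- by rewrite card_units_Zp // totient_double.
Qed.
End GCGroup.

(** * Decomposition by the Chinese remainder theorem *)

Lemma eq_mod_bigprod (I : finType) (q : I -> nat) u v :
    (forall i j, i != j -> coprime (q i) (q j)) ->
  (forall i, u = v %[mod q i]) -> u = v %[mod \prod_i q i].
Proof.
move=> co_q eq_q; apply/eqP.
have := index_enum_uniq I; elim: index_enum => [|i r IHr] /=.
  by rewrite big_nil !modn1.
case/andP=> i_r uniq_r; rewrite big_cons chinese_remainder ?eq_q ?eqxx ?IHr //.
rewrite big_seq; elim/big_ind: _ => [|a b co_a co_b|j j_r]; first exact: coprimen1.
  by rewrite coprimeMr co_a.
by apply: co_q; apply: contraNneq i_r => ->.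
Qed.

Lemma coprime_bigprodr (I : finType) (q : I -> nat) x :
  (forall i, coprime x (q i)) -> coprime x (\prod_i q i).
Proof.
move=> co_q; elim/big_ind: _ => [|a b co_a co_b|i _] //; first exact: coprimen1.
by rewrite coprimeMr co_a.
Qed.

Lemma totient_bigprod (I : finType) (q : I -> nat) :
  (forall i j, i != j -> coprime (q i) (q j)) ->
  totient (\prod_i q i) = \prod_i totient (q i).
Proof.
move=> co_q; have := index_enum_uniq I; elim: index_enum => [|i r IHr] /=.
  by rewrite !big_nil.
case/andP=> i_r uniq_r; rewrite !big_cons totient_coprime ?IHr //.
rewrite big_seq; elim/big_ind: _ => [|a b co_a co_b|j j_r]; first exact: coprimen1.
  by rewrite coprimeMr co_a.
by apply: co_q; apply: contraNneq i_r => ->.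
Qed.

(** The moduli 2a and 2 q_i are not coprime; since the units involved are odd,
    u modulo 2 q_i carries the same information as u modulo q_i, and the
    factor 2 is kept only in 2a. *)
Lemma GC_prod_isog (I : finType) (a : nat) (q : I -> nat) :
    (0 < a)%N -> (forall i, odd (q i)) -> (forall i, coprime a (q i)) ->
    (forall i j, i != j -> coprime (q i) (q j)) ->
  group_isog (setX (GC a) (setXn (fun i => GC (q i))))
    (units_Zp (2 * (a * \prod_i q i))).
Proof.
move=> a_gt0 odd_q co_aq co_q.
have q_gt0 i : 0 < q i by apply: odd_gt0.
have prod_gt0 : 0 < a * \prod_i q i by rewrite muln_gt0 a_gt0 prodn_gt0.
have co_2a i : coprime (2 * a) (q i) by rewrite coprimeMl coprime2n odd_q co_aq.
apply: unit_param_isog; first by lia.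
apply: unit_param_prod (GC_unit_param a_gt0) (fun i => GC_unit_param (q_gt0 i)).
- by rewrite dvdn_pmul2l // dvdn_mulr.
- by move=> i; rewrite dvdn_pmul2l // dvdn_mull // (bigD1 i) //= dvdn_mulr.
- move=> u u_a u_q; apply/eqP; rewrite mulnA chinese_remainder ?u_a ?eqxx.
    apply/eqP/eq_mod_bigprod => // i.
    by rewrite -(modn_dvdm u (dvdn_mull 2 (dvdnn (q i)))) u_q modn_dvdm ?dvdn_mull.
  exact: coprime_bigprodr.
rewrite mulnA (totient_coprime (coprime_bigprodr co_2a)) totient_bigprod //.
rewrite leq_mul2l; apply/orP; right.
by apply: leq_prod => i _; rewrite totient_double.
Qed.

(** * Units modulo a power of two *)

Section PowerOfTwo.
Local Open Scope group_scope.

(** The units modulo N are the automorphisms of a cyclic group of order N; for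
    N = 2^(k+1) these are generated by t and s, acting as -1 and 5. *)
Lemma units_Zp_pow2_isog k : (0 < k)%N ->
  group_isog (units_Zp (2 ^ k.+1)) (setX (Zp 2) (Zp (2 ^ k.-1))).
Proof.
move=> k_gt0; pose N := (2 ^ k.+1)%N; pose a : 'Z_N := Zp1.
have N_gt1 : (1 < N)%N by rewrite -[1%N](expn0 2) ltn_exp2l.
have oa : #[a] = N by rewrite order_Zp1 Zp_cast.
have p_a : 2.-group <[a]> by rewrite /pgroup -/(#[a]) oa pnatX.
have nt_a : <[a]> != 1 by rewrite cycle_eq1 -order_gt1 oa.
have := cyclic_pgroup_Aut_structure p_a (cycle_cyclic a) nt_a.
have logN : logn 2 N = k.+1 by rewrite pfactorK.
rewrite /= -[#|<[a]>|]/(#[a]) oa logN [k.+1.-1]/= => -[m [_ _]].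
rewrite (gtn_eqF k_gt0) => -[t [t_A ot _ struct]].
have [s os def_A] : exists2 s, #[s] = (2 ^ k.-1)%N & <[t]> \x <[s]> = Aut <[a]>.
  (* Modulo 4 the automorphism t alone generates, and s is trivial. *)
  case: eqP struct => [k1 -> | _ [s [_ os _ def_A _]]].
    by exists 1; rewrite ?k1 ?order1 // cycle1 dprodg1.
  by exists s; rewrite // dprodC.
have isoA := Zp_unit_isog a; rewrite oa in isoA.
split; [exact: groupP | exact: groupP |].
apply: isog_trans isoA _.
apply: isog_dprod def_A (setX_dprod _ _) _ _.
- by rewrite isog_sym -ot; apply: isog_trans (Zp_isog t); rewrite isog_sym isog_setX1.
- by rewrite isog_sym -os; apply: isog_trans (Zp_isog s); rewrite isog_sym isog_set1X.
Qed.
End PowerOfTwo.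

Theorem proposition6 (n k t : nat) (p alpha : 'I_t -> nat)
    (n_ge2 : 2 <= n)
    (p_prime : forall i, prime (p i))
    (p_odd : forall i, odd (p i))
    (p_inj : injective p)
    (n_fact : n = 2 ^ k * \prod_(i < t) p i ^ alpha i) :
  [/\ group_isog (GC n)
        (setX (GC (2 ^ k)) (setXn (fun i : 'I_t => GC (p i ^ alpha i)))),
      1 <= k -> group_isog (GC (2 ^ k)) (setX (Zp 2) (Zp (2 ^ (k - 1))))
    & forall i : 'I_t,
        group_isog (GC (p i ^ alpha i)) (units_Zp (p i ^ alpha i))].
Proof.
have k2_gt0 : 0 < 2 ^ k by rewrite expn_gt0.
have odd_q i : odd (p i ^ alpha i) by rewrite oddX p_odd orbT.
have co_q i j : i != j -> coprime (p i ^ alpha i) (p j ^ alpha j).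
  move=> neq_ij; apply/coprimeXl/coprimeXr; rewrite prime_coprime // dvdn_prime2 //.
  by apply: contra neq_ij => /eqP/p_inj->.
have co_2q i : coprime (2 ^ k) (p i ^ alpha i).
  by apply: coprimeXl; rewrite coprime2n.
split.
- apply: (group_isog_trans (GC_isog (ltnW n_ge2))); rewrite n_fact.
  exact/group_isog_sym/GC_prod_isog.
- move=> k_gt0; apply: (group_isog_trans (GC_isog k2_gt0)).
  by rewrite subn1 -expnS; apply: units_Zp_pow2_isog.
- move=> i; have q_gt0 := odd_gt0 (odd_q i).
  exact: group_isog_trans (GC_isog q_gt0) (units_Zp_double_isog (odd_q i)).
Qed.
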